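(* Let $d,k\ge 2$ and let $G$ be a vertex-transitive $(d,k;+1)$-digraph. For $1\le t\le k-1$ let $Z_{k+t}$ be the number of distinct directed $(k+t)$-cycles in $G$. Then for $2\le t\le k-1$ we have $$(M(d,k)+1)(d^{t}-d^{t-1}) = Z_{k+t}\,(k+t).$$
   Context: Digraphs are finite and without multiple arcs. A digraph $G$ is $k$-geodetic if for any (not necessarily distinct) vertices $u,v$ there is at most one directed walk from $u$ to $v$ of length at most $k$ (walks of length $0$ count, so there are no directed cycles of length at most $k$). Put $M(d,k)=1+d+d^2+\dots+d^k$. A $(d,k;+1)$-digraph is a $k$-geodetic digraph with minimum out-degree $d$ and order $M(d,k)+1$. In such a digraph (with $d,k\ge 2$), for every vertex $u$ there is a unique vertex $o(u)$ with $d(u,o(u))\ge k+1$; it is known that such a digraph is diregular and that $o$ is an automorphism. A directed $r$-cycle is a subdigraph isomorphic to the directed cycle on $r$ distinct vertices. *)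

(* Defs.v *)
From mathcomp Require Import all_boot all_fingroup.

Set Implicit Arguments.
Unset Strict Implicit.
Unset Printing Implicit Defensive.

(* A digraph on the vertex set V : finType is an arc relation
   e : rel V; in particular it is finite and has no multiple arcs. *)

Definition outdeg (V : finType) (e : rel V) (u : V) : nat :=
  #|[set v | e u v]|.

Definition min_outdeg_is (V : finType) (e : rel V) (d : nat) : Prop :=
  (forall u : V, d <= outdeg e u) /\ (exists u : V, outdeg e u = d).

(* In mathcomp's [path e u p], the walk is u :: p: it starts at u, ends at
   [last u p], and its length is [size p], so p = [::] is the walk of length 0. *)
Definition k_geodetic (V : finType) (e : rel V) (k : nat) : Prop :=
  forall (u v : V) (p q : seq V),
    path e u p -> last u p = v -> size p <= k ->
    path e u q -> last u q = v -> size q <= k ->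
    p = q.

Definition moore_bound (d k : nat) : nat := \sum_(i < k.+1) d ^ i.

(* These are the (d,k;+1)-digraphs. *)
Definition excess_one_digraph (V : finType) (e : rel V) (d k : nat) : Prop :=
  [/\ k_geodetic e k, min_outdeg_is e d & #|V| = moore_bound d k + 1].

Definition digraph_aut (V : finType) (e : rel V) : {set {perm V}} :=
  [set f : {perm V} | [forall x, forall y, e (f x) (f y) == e x y]].

Definition vertex_transitive (V : finType) (e : rel V) : bool :=
  [transitive digraph_aut e, on [set: V] | 'P].

(* Subdigraphs are pairs H = (vertex set, arc set). *)
Definition is_subdigraph (V : finType) (e : rel V)
    (H : {set V} * {set V * V}) : bool :=
  (H.2 \subset setX H.1 H.1) && [forall a in H.2, e a.1 a.2].

(* H is isomorphic to the directed cycle on 'I_r, whose arcs are the pairs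
   (i, i + 1 mod r); [ordS] is the cyclic successor. *)
Definition iso_dicycle (V : finType) (r : nat)
    (H : {set V} * {set V * V}) : bool :=
  [exists f : {ffun 'I_r -> V},
    [&& injectiveb f, f @: [set: 'I_r] == H.1 &
        [forall i, forall j, ((f i, f j) \in H.2) == (j == ordS i)]]].

(* Cycles are counted as subdigraphs, so the r rotations of a cyclic vertex
   sequence are one and the same cycle. *)
Definition num_dicycles (V : finType) (e : rel V) (r : nat) : nat :=
  #|[set H : {set V} * {set V * V} | is_subdigraph e H && iso_dicycle r H]|.

(* Main.v *)
(** Let [w n u v] be the number of walks of length [n] from [u] to [v] and
    [S u v] the number of those of length at most [k]. Diregularity makes [S]
    a 0/1 matrix whose column [v] vanishes at exactly one vertex [r v] (the
    inverse of the outlier map [o]). Multiplying [S] by the matrix of walks of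
    length [t], and subtracting the same identity for [t - 1], gives
      [w (k + t) u u - w (t - 1) u u
         = d ^ t - d ^ (t - 1) - w t u (r u) + w (t - 1) u (r u)].
    Here [w (t - 1) u u = 0] by geodecity. Also [w s u (r u) = 0] for
    [1 <= s < k]: otherwise, by transitivity, [s] has this property at every
    vertex, and since [r] preserves arcs ([S] commutes with the adjacency
    matrix), an out-neighbour [v] of [u] off the walk from [u] to [r u] yields
    two walks [u -> v ~> r v] and [u ~> r u -> r v] of length [s + 1 <= k],
    against geodecity. Finally, a closed walk of length less than
    [2 (k + 1)] has no repeated vertex, as it would otherwise split
    into two closed walks one of which is too short. *)
Require Import Defs.
From mathcomp Require Import all_boot all_fingroup.
From mathcomp Require Import zify.

Set Implicit Arguments.
Unset Strict Implicit.
Unset Printing Implicit Defensive.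

(** * Counting walks between two vertices *)

Definition nwalks (V : finType) (e : rel V) (n : nat) (u v : V) : nat :=
  #|[set p : n.-tuple V | path e u p && (last u p == v)]|.

Definition nwalks_upto (V : finType) (e : rel V) (k : nat) (u v : V) : nat :=
  \sum_(i < k.+1) nwalks e i u v.

Lemma nwalks_gt0P (V : finType) (e : rel V) (n : nat) (u v : V) :
  reflect (exists p : seq V, [/\ path e u p, last u p = v & size p = n])
          (0 < nwalks e n u v).
Proof.
apply: (iffP card_gt0P) => [[p]|[p [pth lst sz]]].
  by rewrite inE => /andP[pth /eqP lst]; exists p; rewrite size_tuple.
move/eqP: sz => sz; exists (Tuple sz).
by rewrite inE /= pth lst eqxx.
Qed.

Lemma nwalks0 (V : finType) (e : rel V) (u v : V) :
  nwalks e 0 u v = (u == v).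
Proof.
rewrite /nwalks; case: eqP => [->|neq].
  apply/eqP/cards1P; exists [tuple]; apply/setP => p.
  by rewrite tuple0 !inE /= eqxx.
by apply: eq_card0 => p; rewrite tuple0 !inE /=; apply/eqP.
Qed.

Lemma sum_tuple_recl (T : finType) (n : nat) (F : seq T -> nat) :
  \sum_(p : n.+1.-tuple T) F p = \sum_(x : T) \sum_(p : n.-tuple T) F (x :: p).
Proof.
rewrite pair_big /=.
rewrite (reindex (fun q : T * n.-tuple T => [tuple of q.1 :: q.2])) //=.
exists (fun p => (thead p, [tuple of behead p])) => [[x p] _|p _] /=.
  by congr (_, _); apply: val_inj.
by rewrite -tuple_eta.
Qed.

Lemma nwalksE (V : finType) (e : rel V) (n : nat) (u v : V) :
  nwalks e n u v = \sum_(p : n.-tuple V) (path e u p && (last u p == v)).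
Proof.
rewrite /nwalks -sum1_card big_mkcond; apply: eq_bigr => p _.
by rewrite inE; case: ifP.
Qed.

Lemma nwalksS (V : finType) (e : rel V) (n : nat) (u v : V) :
  nwalks e n.+1 u v = \sum_(w : V) e u w * nwalks e n w v.
Proof.
rewrite nwalksE (sum_tuple_recl n (fun p => path e u p && (last u p == v))).
apply: eq_bigr => w _; rewrite nwalksE big_distrr /=; apply: eq_bigr => p _.
by case: (e u w); rewrite ?mul1n ?mul0n.
Qed.

Lemma nwalksD (V : finType) (e : rel V) (m n : nat) (u v : V) :
  nwalks e (m + n) u v = \sum_(w : V) nwalks e m u w * nwalks e n w v.
Proof.
elim: m u => [|m IHm] u.
  rewrite (bigD1 u) //= nwalks0 eqxx mul1n big1 ?addn0 // => w.
  by rewrite nwalks0 eq_sym => /negbTE->.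
rewrite addSn nwalksS.
under eq_bigr => w _ do rewrite IHm big_distrr /=.
rewrite exchange_big; apply: eq_bigr => w _ /=.
by rewrite nwalksS big_distrl /=; apply: eq_bigr => x _; rewrite mulnA.
Qed.

Lemma nwalks1 (V : finType) (e : rel V) (u v : V) : nwalks e 1 u v = e u v.
Proof.
rewrite nwalksS (bigD1 v) //= nwalks0 eqxx muln1 big1 ?addn0 // => w.
by rewrite nwalks0 => /negbTE->; rewrite muln0.
Qed.

Lemma sum_nat_indicator (V : finType) (P : pred V) :
  \sum_(v : V) P v = #|[set v | P v]|.
Proof.
rewrite cardsE -sum1_card [RHS]big_mkcond; apply: eq_bigr => v _.
by rewrite unfold_in; case: (P v).
Qed.

Lemma sum_nwalks_out (V : finType) (e : rel V) (d n : nat) (u : V) :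
  (forall x, outdeg e x = d) -> \sum_(v : V) nwalks e n u v = d ^ n.
Proof.
move=> reg; elim: n u => [|n IHn] u.
  rewrite (bigD1 u) //= nwalks0 eqxx big1 // => w.
  by rewrite nwalks0 eq_sym => /negbTE->.
under eq_bigr => v _ do rewrite nwalksS.
rewrite exchange_big /=.
under eq_bigr => v _ do rewrite -big_distrr /= IHn.
by rewrite -big_distrl /= sum_nat_indicator -/(outdeg e u) reg -expnS.
Qed.

Lemma sum_nwalks_in (V : finType) (e : rel V) (d n : nat) (v : V) :
  (forall x, #|[set y | e y x]| = d) -> \sum_(u : V) nwalks e n u v = d ^ n.
Proof.
move=> reg; elim: n v => [|n IHn] v.
  rewrite (bigD1 v) //= nwalks0 eqxx big1 // => w.
  by rewrite nwalks0 => /negbTE->.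
under eq_bigr => u _ do rewrite -addn1 nwalksD.
rewrite exchange_big /=.
under eq_bigr => w _ do rewrite -big_distrl /= IHn nwalks1.
by rewrite -big_distrr /= sum_nat_indicator reg -expnSr.
Qed.

(** * Automorphisms and their action on walk counts *)

Lemma group_set_digraph_aut (V : finType) (e : rel V) :
  group_set (digraph_aut e).
Proof.
apply/group_setP; split.
  by rewrite inE; apply/forallP => x; apply/forallP => y; rewrite !perm1.
move=> f g; rewrite !inE => /forallP autf /forallP autg.
apply/forallP => x; apply/forallP => y; rewrite !permM.
by rewrite (eqP (forallP (autg _) _)) (eqP (forallP (autf _) _)).
Qed.

Lemma vertex_transitive_aut (V : finType) (e : rel V) (u v : V) :
  vertex_transitive e -> exists2 f, f \in digraph_aut e & v = f u.
Proof.
rewrite /vertex_transitive.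
rewrite -[digraph_aut e]/(gval (Group (group_set_digraph_aut e))).
by move=> tr; have [//|//|f autf ->] := atransP2 tr (x := u) (y := v); exists f.
Qed.

Lemma nwalks_aut (V : finType) (e : rel V) (f : {perm V}) (n : nat) (u v : V) :
  f \in digraph_aut e -> nwalks e n (f u) (f v) = nwalks e n u v.
Proof.
rewrite inE => /forallP aut; elim: n u => [|n IHn] u.
  by rewrite !nwalks0 (inj_eq perm_inj).
rewrite !nwalksS (reindex_inj (@perm_inj _ f)) /=; apply: eq_bigr => w _.
by rewrite IHn (eqP (forallP (aut u) w)).
Qed.

(** * Walk counts under geodecity, and 0/1 matrices *)

Lemma nwalks_upto_le1 (V : finType) (e : rel V) (k : nat) (u v : V) :
  k_geodetic e k -> nwalks_upto e k u v <= 1.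
Proof.
move=> geo.
have le1 (i : 'I_k.+1) : nwalks e i u v <= 1.
  apply/card_le1P => p; rewrite inE => /andP[pp /eqP lp] q.
  rewrite !inE; apply/andP/eqP => [[pq /eqP lq]|->]; last by rewrite lp.
  by apply: val_inj; apply: (geo u v) => //; rewrite size_tuple -ltnS.
rewrite /nwalks_upto.
have [/existsP[i0 gt0]|] := boolP [exists i : 'I_k.+1, 0 < nwalks e i u v].
  rewrite (bigD1 i0) //= big1 ?addn0 // => i neq.
  (* Walks of lengths [i0] and [i] with the same ends are equal by geodecity, so the lengths
     agree. *)
  apply/eqP; rewrite -leqn0 leqNgt; apply: contra neq => gt0'.
  have /nwalks_gt0P[p [pp lp sp]] := gt0.
  have /nwalks_gt0P[q [pq lq sq]] := gt0'.
  apply/eqP/val_inj; rewrite /= -sp -sq; congr size.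
  by apply: (geo u v) => //; rewrite ?sp ?sq -ltnS.
rewrite negb_exists => /forallP none.
by rewrite big1 // => i _; apply/eqP; rewrite -leqn0 leqNgt none.
Qed.

Lemma nwalks_le_upto (V : finType) (e : rel V) (k n : nat) (u v : V) :
  n <= k -> nwalks e n u v <= nwalks_upto e k u v.
Proof.
rewrite -ltnS => lt; rewrite /nwalks_upto (bigD1 (Ordinal lt)) //=.
exact: leq_addr.
Qed.

Lemma nwalks_closed_short (V : finType) (e : rel V) (k n : nat) (u : V) :
  k_geodetic e k -> 0 < n <= k -> nwalks e n u u = 0.
Proof.
move=> geo /andP[n0 nk]; have := nwalks_upto_le1 u u geo.
have lt : n < k.+1 by [].
rewrite /nwalks_upto (bigD1 ord0) //= (bigD1 (Ordinal lt)) /=; last first.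
  by rewrite -(inj_eq val_inj) /= -lt0n.
by rewrite nwalks0 eqxx; lia.
Qed.

(** For values in {0, 1}, [F x + (F x == 0)] is always 1, so the sum leaves room for exactly one
    zero. *)
Lemma sum_nat_corank1 (T : finType) (F : T -> nat) :
  (forall x, F x <= 1) -> \sum_x F x + 1 = #|T| ->
  exists a, forall x, F x = (x != a).
Proof.
move=> le1 tot.
have : \sum_x (F x == 0) = 1.
  apply: (@addnI (\sum_x F x)); rewrite tot -big_split /= -sum1_card.
  by apply: eq_bigr => x _; have := le1 x; case: (F x) => [|[]].
rewrite sum_nat_indicator => /eqP/cards1P[a defa].
exists a => x; have := le1 x; have: (x \in [set v | F v == 0]) = (x == a).
  by rewrite defa inE.
by rewrite inE => <-; case: (F x) => [|[]].
Qed.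

Lemma sum_delta (T : finType) (a : T) (F : T -> nat) :
  \sum_x F x * (x == a) = F a.
Proof.
rewrite (bigD1 a) //= eqxx muln1 big1 ?addn0 // => x /negbTE->.
by rewrite muln0.
Qed.

Lemma sum_codelta (T : finType) (a : T) (F : T -> nat) :
  \sum_x F x * (x != a) + F a = \sum_x F x.
Proof.
rewrite -[X in _ + X](sum_delta a F) -big_split /=; apply: eq_bigr => x _.
by case: (x == a); rewrite muln1 muln0 ?addn0.
Qed.

(** Both products count walks of lengths [n + i] for [i] up to [k]: powers of one matrix commute. *)
Lemma nwalks_upto_comm (V : finType) (e : rel V) (k n : nat) (u v : V) :
  \sum_w nwalks e n u w * nwalks_upto e k w v
  = \sum_w nwalks_upto e k u w * nwalks e n w v.
Proof.
rewrite /nwalks_upto.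
under eq_bigr => w _ do rewrite big_distrr /=.
under [RHS]eq_bigr => w _ do rewrite big_distrl /=.
rewrite exchange_big [RHS]exchange_big /=; apply: eq_bigr => i _.
by rewrite -!nwalksD addnC.
Qed.

Lemma sum_nwalks_upto (V : finType) (e : rel V) (k n : nat) (u v : V) :
  \sum_w nwalks e n u w * nwalks_upto e k w v
  = \sum_(i < k.+1) nwalks e (n + i) u v.
Proof.
under eq_bigr => w _ do rewrite big_distrr /=.
by rewrite exchange_big /=; apply: eq_bigr => i _; rewrite -nwalksD.
Qed.

(** * Diregularity and the co-outlier map [r] *)

Lemma excess_one_regular (V : finType) (e : rel V) (d k : nat) :
  excess_one_digraph e d k -> vertex_transitive e ->
  (forall u, outdeg e u = d) /\ (forall u, #|[set v | e v u]| = d).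
Proof.
case=> _ [_ [u0 deg_u0]] _ tr.
have autE f x y : f \in digraph_aut e -> e (f x) (f y) = e x y.
  by rewrite inE => /forallP/(_ x)/forallP/(_ y)/eqP.
have outreg u : outdeg e u = d.
  have [f aut ->] := vertex_transitive_aut u0 u tr.
  rewrite -deg_u0 /outdeg -!sum_nat_indicator (reindex_inj (@perm_inj _ f)) /=.
  by apply: eq_bigr => v _; rewrite autE.
split=> // u.
have inreg v : #|[set w | e w v]| = #|[set w | e w u]|.
  have [f aut ->] := vertex_transitive_aut u v tr.
  rewrite -!sum_nat_indicator (reindex_inj (@perm_inj _ f)) /=.
  by apply: eq_bigr => w _; rewrite autE.
have V_gt0 : 0 < #|V| by apply/card_gt0P; exists u0.
(* All arcs are counted twice, by heads and by tails; the in-degree is constant by transitivity. *)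
apply/eqP; rewrite -(eqn_pmul2l V_gt0) -!sum_nat_const; apply/eqP.
under eq_bigr => v _ do rewrite -(inreg v) -sum_nat_indicator.
rewrite exchange_big; apply: eq_bigr => v _ /=.
by rewrite sum_nat_indicator -/(outdeg e v).
Qed.

(** By in-regularity each column of the 0/1 matrix sums to [moore_bound d k], one less than the
    order. *)
Lemma cooutlier_exists (V : finType) (e : rel V) (d k : nat) :
  excess_one_digraph e d k -> (forall u, #|[set v | e v u]| = d) ->
  exists r : V -> V, forall v u, nwalks_upto e k u v = (u != r v).
Proof.
move=> [geo _ cardV] inreg.
suff ex v : exists a, forall u, nwalks_upto e k u v = (u != a) :> nat.
  have [r rE] := fin_all_exists ex; by exists r.
apply: sum_nat_corank1 => [u|]; first exact: nwalks_upto_le1.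
rewrite cardV exchange_big /=; congr (_ + 1); apply: eq_bigr => i _.
exact: sum_nwalks_in.
Qed.

Section CoOutlier.

Context (V : finType) (e : rel V) (d k : nat) (r : V -> V).
Context (geo : k_geodetic e k).
Context (outreg : forall x, outdeg e x = d).
Context (inreg : forall x, #|[set y | e y x]| = d).
Context (rE : forall v u, nwalks_upto e k u v = (u != r v)).

(** Compare the entry at [(r u, v)] of the two products of the adjacency matrix with [nwalks_upto].
    One is [d] minus the indicator of the desired arc; the other is at most [d - 1], since the
    in-neighbour [u] of [v] contributes nothing. *)
Lemma cooutlier_arc (u v : V) : e u v -> e (r u) (r v).
Proof.
move=> uv; have := nwalks_upto_comm e k 1 (r u) v.
under eq_bigr => w _ do rewrite rE nwalks1.
under [RHS]eq_bigr => w _ do rewrite mulnC nwalks1 rE.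
have := sum_codelta (r v) (fun w => nat_of_bool (e (r u) w)).
rewrite /= sum_nat_indicator -/(outdeg e (r u)) outreg.
have : \sum_w e w v * (r u != r w) + 1 <= d.
  rewrite -(inreg v) -sum_nat_indicator (bigD1 u) //= eqxx muln0 add0n.
  rewrite [leqRHS](bigD1 u) //= uv addnC leq_add2l.
  by apply: leq_sum => w _; case: (e w v) => //; case: (_ != _).
by case: (e (r u) (r v)) => //; lia.
Qed.

(** Automorphisms preserve [nwalks_upto], so they carry the unique zero of column [u] to that of
    column [f u]. *)
Lemma cooutlier_aut (f : {perm V}) (u : V) :
  f \in digraph_aut e -> r (f u) = f (r u).
Proof.
move=> aut; apply/eqP; apply: contraT => neq.
have := rE (f u) (f (r u)); rewrite eq_sym neq.
have -> : nwalks_upto e k (f (r u)) (f u) = nwalks_upto e k (r u) u.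
  by apply: eq_bigr => i _; apply: nwalks_aut.
by rewrite rE eqxx.
Qed.

Lemma nwalks_cooutlier (s : nat) (u : V) :
  vertex_transitive e -> 2 <= d -> 0 < s < k -> nwalks e s u (r u) = 0.
Proof.
move=> tr d2 /andP[]; case: s => // s _ sk.
apply/eqP; rewrite -leqn0 leqNgt; apply/negP => gt0.
have all_gt0 v : 0 < nwalks e s.+1 v (r v).
  have [f aut ->] := vertex_transitive_aut u v tr.
  by rewrite cooutlier_aut ?nwalks_aut.
move: gt0; rewrite nwalksS lt0n sum_nat_eq0 negb_forall => /existsP[w].
rewrite /= muln_eq0 negb_or eqb0 negbK -lt0n => /andP[uw wru].
(* Here [w] is the first vertex after [u] on the walk to [r u]; a second out-neighbour exists as [d]
   is at least 2. *)
have [v uv vw] : exists2 v, e u v & v != w.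
  have := cardsD1 w [set v | e u v]; rewrite -/(outdeg e u) outreg inE uw => dE.
  have /card_gt0P[v] : 0 < #|[set v | e u v] :\ w| by lia.
  by rewrite !inE => /andP[? ?]; exists v.
have wrv : 0 < nwalks e s.+1 w (r v).
  rewrite -(addn1 s) nwalksD (bigD1 (r u)) //= nwalks1 cooutlier_arc // muln1.
  by rewrite ltn_addr.
(* Walks through [v] and through [w] both reach [r v] in [s.+2] steps, which is at most [k], so the
   count is at least 2. *)
have := leq_trans (nwalks_le_upto e u (r v) sk) (nwalks_upto_le1 _ _ geo).
rewrite nwalksS (bigD1 v) //= (bigD1 w) /= 1?eq_sym // uv uw !mul1n.
by have := all_gt0 v; lia.
Qed.

Lemma nwalks_closed (t : nat) (u : V) :
  vertex_transitive e -> 2 <= d -> 2 <= t <= k.-1 ->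
  nwalks e (k + t) u u = d ^ t - d ^ t.-1.
Proof.
case: t => // t tr d2 /andP[t1 tk] /=.
have sumE n : \sum_(i < k.+1) nwalks e (n + i) u u + nwalks e n u (r u) = d ^ n.
  rewrite -sum_nwalks_upto -(sum_nwalks_out n u outreg).
  rewrite -(sum_codelta (r u) (nwalks e n u)).
  by under eq_bigr => w _ do rewrite rE.
(* After the case split the exponents are [t] and [t.+1]. The two windows of lengths share [t + 1]
   to [t + k], so subtracting leaves only their outer ends. *)
have Et := sumE t; have Et1 := sumE t.+1.
rewrite nwalks_cooutlier ?addn0 in Et; [|by []|by []|lia].
rewrite big_ord_recl /= addn0 (nwalks_closed_short _ geo) in Et; last lia.
rewrite nwalks_cooutlier ?addn0 in Et1; [|by []|by []|lia].
rewrite big_ord_recr /= in Et1.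
rewrite -Et -Et1 add0n [k + _]addnC.
under [X in _ = _ - X]eq_bigr => i _ do rewrite addnS -addSn.
by rewrite addKn.
Qed.

End CoOutlier.

(** * Short closed walks have no repeated vertex *)

Lemma not_uniq_split (T : eqType) (s : seq T) :
  ~~ uniq s -> exists x p1 p2 p3, s = p1 ++ x :: p2 ++ x :: p3.
Proof.
elim: s => //= a s IHs.
rewrite negb_and negbK => /orP[/path.splitPr[p1 p2]|/IHs].
  by exists a, [::], p1, p2.
by case=> x [p1 [p2 [p3 ->]]]; exists x, (a :: p1), p2, p3.
Qed.

Lemma geodetic_cycle_uniq (V : finType) (e : rel V) (k : nat) (s : seq V) :
  k_geodetic e k -> path.cycle e s -> size s < 2 * k.+1 -> uniq s.
Proof.
move=> geo cyc sz; apply: contraT => nuniq.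
have [x [p1 [p2 [p3 defs]]]] : exists (x : V) (p1 p2 p3 : seq V),
  s = p1 ++ x :: p2 ++ x :: p3 := not_uniq_split nuniq.
(* Rotating to the repeated vertex [x] displays two closed walks at [x], of lengths [size p2 + 1]
   and [size (p3 ++ p1) + 1]. *)
have : path.cycle e (x :: p2 ++ x :: p3 ++ p1).
  by rewrite -(rot_cycle (size p1)) defs rot_size_cat /= -catA in cyc *.
have none q : path e x (rcons q x) -> size q < k -> False.
  move=> pth lt; have := geo x x (rcons q x) [::] pth.
  rewrite last_rcons size_rcons => /(_ erefl lt erefl erefl erefl).
  by case: q {pth lt}.
rewrite /= rcons_cat /= -cat_rcons cat_path last_rcons.
case/andP=> /none no2 /none; rewrite size_cat => no3; exfalso.
move: sz; rewrite defs !size_cat /= size_cat /= => sz.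
have [/no2//|le2] := ltnP (size p2) k; apply: no3; lia.
Qed.


(** * Cycles as subdigraphs and as rooted vertex sequences *)

Definition seq_dicycle (V : finType) (s : seq V) : {set V} * {set V * V} :=
  ([set x | x \in s], [set a | (a.1 \in s) && (a.2 == next s a.1)]).

Lemma next_tnth (T : eqType) (n : nat) (t : n.-tuple T) (i : 'I_n) :
  uniq t -> next t (tnth t i) = tnth t (ordS i).
Proof.
case: n t i => [? []//|n] t i uniqt.
rewrite next_nth mem_tnth; case/tupleP: t uniqt => x t uniqt.
rewrite !(tnth_nth x) index_uniq ?size_tuple //=.
(* At the last index, [nth] runs past the tail and returns its default, the head [x]; this matches
   the wrap-around of [ordS]. *)
have := ltn_ord i; rewrite ltnS leq_eqVlt => /orP[/eqP->|lt].
  by rewrite modnn nth_default // size_tuple.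
by rewrite modn_small.
Qed.

Lemma seq_dicycleP (V : finType) (e : rel V) (n : nat)
    (H : {set V} * {set V * V}) :
  reflect (exists t : n.-tuple V,
             [/\ path.cycle e t, uniq t & H = seq_dicycle t])
          (is_subdigraph e H && iso_dicycle n H).
Proof.
apply: (iffP andP) => [[/andP[sub /forall_inP arc]]|[t [cyc uniqt ->]]].
  case/existsP=> f /and3P[/injectiveP injf /eqP imf /forallP isof].
  have [t tE] : exists t : n.-tuple V, forall i, tnth t i = f i.
    by exists [tuple f i | i < n] => i; rewrite tnth_mktuple.
  have uniqt : uniq t.
    by apply/tuple_uniqP => i j; rewrite !tE => /injf.
  have mem_t x : (x \in t) = (x \in H.1).
    rewrite -imf.
    by apply/tnthP/imsetP => [[i ->]|[i _ ->]]; exists i; rewrite ?tE.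
  have isoE i j : ((f i, f j) \in H.2) = (f j == next t (f i)).
    rewrite (eqP (forallP (isof i) j)) -[f i in RHS](tE i).
    by rewrite next_tnth // tE (inj_eq injf).
  have setE : H = seq_dicycle t.
    rewrite [H]surjective_pairing; congr (_, _).
      by apply/setP => x; rewrite inE mem_t.
    (* The isomorphism only controls pairs in the image of [f]; being a subdigraph confines all arcs
       of [H] to that image. *)
    apply/setP => -[x y]; rewrite inE /=; apply/idP/andP => [Hxy|[]].
      have := subsetP sub _ Hxy; rewrite inE /= => /andP[Hx Hy].
      rewrite mem_t Hx; split=> //; move: Hx Hy Hxy; rewrite -imf.
      by case/imsetP=> i _ ->; case/imsetP=> j _ ->; rewrite isoE.
    case/tnthP=> i ->; rewrite next_tnth // !tE => /eqP->.
    by rewrite isoE -[f i](tE i) next_tnth // tE.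
  exists t; split=> //; apply: cycle_from_next => // x tx.
  by apply: (arc (x, next t x)); rewrite setE inE /= tx eqxx.
split.
  apply/andP; split.
    apply/subsetP => -[x y]; rewrite !inE /= => /andP[tx /eqP->].
    by rewrite mem_next tx.
  apply/forall_inP => -[x y]; rewrite inE /= => /andP[tx /eqP->].
  exact: next_cycle.
apply/existsP; exists [ffun i => tnth t i].
have injt : injective (tnth t) by apply/tuple_uniqP.
apply/and3P; split.
- by apply/injectiveP => i j; rewrite !ffunE => /injt.
- apply/eqP/setP => x; rewrite inE; apply/imsetP/tnthP => [[i _ ->]|[i ->]].
    by exists i; rewrite ffunE.
  by exists i; rewrite ?ffunE.
apply/forallP => i; apply/forallP => j.
by rewrite inE /= !ffunE mem_tnth next_tnth // (inj_eq injt).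
Qed.

Lemma seq_dicycle_next (V : finType) (s1 s2 : seq V) :
  seq_dicycle s1 = seq_dicycle s2 -> next s1 =1 next s2.
Proof.
case=> /setP verts /setP arcs x; have := verts x; rewrite !inE.
have [s1x|s1x] := boolP (x \in s1) => s2x; last first.
  (* Off the sequence, [next] is the identity. *)
  by rewrite !next_nth -s2x (negbTE s1x).
by have := arcs (x, next s1 x); rewrite !inE /= s1x -s2x eqxx => /esym/eqP.
Qed.

(** Each sequence is the trajectory of [x] under its successor map; equal maps and equal lengths
    give equal trajectories. *)
Lemma seq_dicycle_inj (V : finType) (x : V) (p1 p2 : seq V) :
  size p1 = size p2 -> uniq (x :: p1) -> uniq (x :: p2) ->
  seq_dicycle (x :: p1) = seq_dicycle (x :: p2) -> p1 = p2.
Proof.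
move=> sz /cycle_next + /cycle_next + /seq_dicycle_next eqnext.
have eqf : frel (next (x :: p1)) =2 frel (next (x :: p2)).
  by move=> y z; congr (_ == _); apply: eqnext.
rewrite -(eq_cycle eqf); move: (next (x :: p1)) => f /=.
move=> /fpathP[m1 eq1] /fpathP[m2 eq2].
have [sz1 sz2] : size (rcons p1 x) = m1 /\ size (rcons p2 x) = m2.
  by rewrite eq1 eq2 !size_traject.
have := eq1; rewrite -sz1 size_rcons sz -(size_rcons p2 x) sz2 -eq2.
by move/rcons_inj => [].
Qed.

(** Both sides count cycles with a marked vertex: a repetition-free closed sequence amounts to its
    cycle marked at its head. *)
Lemma num_dicyclesE (V : finType) (e : rel V) (n : nat) :
  num_dicycles e n.+1 * n.+1
  = #|[set t : n.+1.-tuple V | path.cycle e t && uniq t]|.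
Proof.
pose rooted := [set a : {set V} * {set V * V} * V |
  (is_subdigraph e a.1 && iso_dicycle n.+1 a.1) && (a.2 \in a.1.1)].
pose root_cycle (t : n.+1.-tuple V) := (seq_dicycle t, thead t).
have rootedE :
    root_cycle @: [set t : n.+1.-tuple V | path.cycle e t && uniq t] = rooted.
  apply/setP => -[H v]; rewrite inE /=.
  apply/imsetP/andP => [[t]|[/seq_dicycleP[t [cyc uniqt ->]]]].
    rewrite inE => /andP[cyc uniqt] [-> ->]; split.
      by apply/seq_dicycleP; exists t.
    by rewrite inE mem_tnth.
  (* Rotating [t] to begin at [v] keeps the cycle and moves the mark to [v]. *)
  rewrite inE => tv; have sz : size (rot (index v t) t) == n.+1.
    by rewrite size_rot size_tuple.
  exists (Tuple sz); first by rewrite inE /= rot_cycle rot_uniq cyc.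
  congr (_, _); last first.
    by rewrite /thead (tnth_nth v) /= nth0 (rot_index tv).
  congr (_, _); apply/setP => x; rewrite !inE /= mem_rot //.
  by rewrite next_rot.
transitivity #|rooted|.
  rewrite /num_dicycles /rooted -!sum1dep_card big_distrl /=.
  transitivity (\sum_(H | is_subdigraph e H && iso_dicycle n.+1 H)
    \sum_(v in H.1) 1); last by rewrite pair_big_dep.
  apply: eq_bigr => H /seq_dicycleP[t [_ uniqt ->]].
  by rewrite mul1n sum1_card cardsE (card_uniqP uniqt) size_tuple.
rewrite -rootedE card_in_imset // => t1 t2; rewrite !inE.
move=> /andP[_ uniq1] /andP[_ uniq2] [].
case/tupleP: t1 uniq1 => x p1 uniq1; case/tupleP: t2 uniq2 => y p2 uniq2.
move=> vs arcs; rewrite !theadE => exy; apply: val_inj.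
rewrite -{y}exy /= in uniq2 vs arcs *.
congr (_ :: _); apply: (@seq_dicycle_inj _ x) => //.
  by rewrite !size_tuple.
by rewrite /seq_dicycle vs arcs.
Qed.

(** The tuples counted by [nwalks] omit the starting vertex, and a closed walk ends where it starts,
    so only [u = last x p] contributes for each tuple. *)
Lemma sum_nwalks_closed (V : finType) (e : rel V) (n : nat) :
  \sum_(u : V) nwalks e n.+1 u u = #|[set t : n.+1.-tuple V | path.cycle e t]|.
Proof.
under eq_bigr => u _ do rewrite nwalksE.
rewrite exchange_big -sum_nat_indicator /=; apply: eq_bigr => t _.
case/tupleP: t => x p; rewrite (cycle_path x) /=.
rewrite (bigD1 (last x p)) //= eqxx andbT big1 ?addn0 // => u neq.
by rewrite [last x p == u]eq_sym (negbTE neq) andbF.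
Qed.

Theorem theorem1 (d k : nat) (hd : 2 <= d) (hk : 2 <= k)
    (V : finType) (e : rel V)
    (hG : excess_one_digraph e d k) (htr : vertex_transitive e)
    (t : nat) (ht : 2 <= t <= k.-1) :
  (moore_bound d k + 1) * (d ^ t - d ^ t.-1)
  = num_dicycles e (k + t) * (k + t).
Proof.
have [geo _ <-] := hG.
have [outreg inreg] := excess_one_regular hG htr.
have [r rE] := cooutlier_exists hG inreg.
transitivity (\sum_u nwalks e (k + t) u u).
  rewrite -sum_nat_const; apply: eq_bigr => u _.
  by rewrite (nwalks_closed geo outreg inreg rE).
have ktE : k + t = (k + t).-1.+1 by lia.
rewrite ktE sum_nwalks_closed num_dicyclesE; apply: eq_card => c.
rewrite !inE; case: (boolP (path.cycle e c)) => //= cyc.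
(* The length [k + t] is at most [2 * k - 1], within the bound [2 * k.+1]. *)
by rewrite (geodetic_cycle_uniq geo cyc) // size_tuple; lia.
Qed.
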